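(* Let $G$ be a finite group and $V$ a finite faithful $G$-module with $(|G|,|V|)=1$. Suppose that $G$ has a regular orbit on $V$, i.e. there is $v\in V$ with $C_G(v)=1$. Then $$k(GV)\leq |V|-|G|+k(G).$$
   Context: A finite $G$-module here is a finite vector space over a field of prime characteristic $p$ on which $G$ acts linearly. $GV$ denotes the semidirect product of $V$ by $G$ with respect to this action, $C_G(v)$ is the stabilizer of $v$ in $G$, and $k(X)$ is the number of conjugacy classes of a finite group $X$. *)

(* Defs.v *)
From mathcomp Require Import all_boot all_order all_fingroup all_algebra all_solvable.

Set Implicit Arguments.
Unset Strict Implicit.
Unset Printing Implicit Defensive.

(* The (additive) finite group underlying V carries the group action, which is
   already additive for elements of G; [linear] adds compatibility with the
   scalars.  MathComp groups act on the right. *)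
Definition linear_action (F : fieldType) (V : finLmodType F)
    (gT : finGroupType) (G : {group gT}) (to : groupAction G [set: V]) : Prop :=
  forall g : gT, g \in G -> linear (fun u : V => (to u g : V)).

(* Main.v *)
(** Let w in V be a nonzero vector with trivial stabilizer, so that w has prime
    order p and its centralizer in GV is V.  Column orthogonality at each of
    the p - 1 generators x of W = <w> reads
      |V| = sum_chi |chi(x)|^2,
    and the characters inflated from G contribute |G| to this sum.  The other
    k(GV) - k(G) irreducible characters contribute at least 1 each on average
    over x: by Ito's theorem chi(1) divides |G|, so p does not divide chi(1);
    hence the multiplicities a_i of the p linear characters of W in chi are
    not all equal, and
      sum_(x in W^#) |chi(x)|^2 = p (sum a_i^2) - (sum a_i)^2
                                = sum_(i < j) (a_i - a_j)^2 >= p - 1. *)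
Require Import Defs.
From mathcomp Require Import all_boot all_order all_fingroup all_algebra all_solvable.
From mathcomp Require Import all_field all_character.
From mathcomp Require Import ring lra.

Set Implicit Arguments.
Unset Strict Implicit.
Unset Printing Implicit Defensive.
Import Order.TTheory GRing.Theory Num.Theory.
Local Open Scope group_scope.
Local Open Scope ring_scope.

Lemma sum_sqr_dist (R : comPzRingType) (I : finType) (a : I -> R) :
  \sum_i \sum_j (a i - a j) ^+ 2
    = (#|I|%:R * (\sum_i a i ^+ 2) - (\sum_i a i) ^+ 2) *+ 2.
Proof.
set S := \sum_i a i; set Q := \sum_i a i ^+ 2.
transitivity (\sum_i (a i ^+ 2 *+ #|I| - a i * S *+ 2 + Q)).
  apply: eq_bigr => i _; under eq_bigr do rewrite sqrrB.
  by rewrite big_split sumrB sumr_const sumrMnl mulr_sumr.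
rewrite big_split sumrB sumr_const !sumrMnl -mulr_suml /= -/S -/Q.
by rewrite -[Q *+ _]mulr_natl; ring.
Qed.

(** A family [a] with constant value c would have sum #|I| c, so [a] takes two distinct values, and
    integers that differ have squared distance at least 1. *)
Lemma sum_sqr_ndvd (I : finType) (a : I -> int) :
    ~~ (#|I| %| \sum_i a i)%Z ->
  #|I|%:Z - 1 + (\sum_i a i) ^+ 2 <= #|I|%:Z * \sum_i a i ^+ 2.
Proof.
move=> ndv; have sum1I : \sum_(i : I) (1 : int) = #|I|%:Z.
  by rewrite sumr_const natz.
have [i [j neq_ij]] : exists i, exists j, a i != a j.
  have [/existsP[i /existsP[j]] | /existsPn a_const] :=
      boolP [exists i, exists j, a i != a j]; first by exists i, j.
  case/negP: ndv; have [i _ | I0] := pickP (mem I); last first.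
    by rewrite big_pred0.
  rewrite (eq_bigr (fun=> a i)) => [|j _].
    by rewrite sumr_const -mulr_natr natz dvdz_mull.
  by have /existsPn/(_ i)/negPn/eqP := a_const j.
pose D k := \sum_l (a k - a l) ^+ 2.
have sqr_ge1 (x y : int) : x != y -> 1 <= (x - y) ^+ 2.
  by move=> neq; rewrite -gtz0_ge1 lt_def sqr_ge0 sqrf_eq0 subr_eq0 neq.
(* Both bounds hold because each a k differs from a i or from a j. *)
have D_ge1 k : 1 <= D k.
  have [l neq_kl] : exists l, a k != a l.
    have [eq_ki | ] := eqVneq (a k) (a i); last by exists i.
    by exists j; rewrite eq_ki.
  rewrite /D (bigD1 l) //= -[1]addr0 lerD ?sqr_ge1 ?sumr_ge0 // => m _.
  exact: sqr_ge0.
have D_ij : #|I|%:Z <= D i + D j.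
  rewrite /D -big_split -sum1I /=; apply: ler_sum => l _.
  have [eq_il | neq_il] := eqVneq (a i) (a l).
    by rewrite -[1]add0r lerD ?sqr_ge0 ?sqr_ge1 // -eq_il eq_sym.
  by rewrite -[1]addr0 lerD ?sqr_ge0 ?sqr_ge1.
have neq_ji : j != i by apply: contraNneq neq_ij => ->.
(* With n = #|I|, the rows i and j give n together and the other n - 2 rows at least 1 each. The
   total 2(n - 1) is halved, as ordered pairs count each difference twice. *)
have := sum_sqr_dist a; rewrite natz -[LHS]/(\sum_k D k).
move: sum1I; rewrite !(bigD1 i (P := predT)) //= !(bigD1 j neq_ji) /=.
have : \sum_(k | (k != i) && (k != j)) 1 <= \sum_(k | (k != i) && (k != j)) D k.
  exact: ler_sum.
lra.
Qed.

(** By Clifford correspondence ['chi_i] is induced from some ['chi_s] of the inertia group T, so its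
    degree is |X : T| ['chi_s](1). As A is central modulo the kernel of ['chi_s], ['chi_s](1)
    divides |T : A|. *)
Lemma Ito_degree (gT : finGroupType) (A X : {group gT}) (i : Iirr X) :
  A <| X -> abelian A -> ('chi_i 1%g %| #|X : A|)%C.
Proof.
move=> nsAX cAA; have [sAX nAX] := andP nsAX.
have /neq0_has_constt[t At] : 'Res[A] 'chi_i != 0 by apply: Res_irr_neq0.
pose T := 'I_X['chi_t]%G.
have [IndT _ imInd _ _] := constt_Inertia_bijection t nsAX.
have := imInd i; rewrite constt_Ind_Res At => /imsetP[s Ts Di].
have sAT : A \subset T by apply: sub_Inertia.
have nsAT : A <| T by apply: normal_Inertia.
have sTX : T \subset X by apply: subsetIl.
(* 'chi_s restricts on A to a multiple of the T-invariant linear 'chi_t. *)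
have sAZ : A \subset 'Z('chi_s)%CF.
  apply/subsetP=> x Ax; rewrite irr_cfcenterE ?(subsetP sAT) //.
  rewrite constt_Ind_Res in Ts.
  have lin_t : 'chi_t \is a linear_char by apply/char_abelianP.
  have /natrP[e De] : '['Res[A] 'chi_s, 'chi_t] \in Num.nat.
    by rewrite Cnat_cfdot_char ?cfRes_char ?irr_char.
  rewrite -!(cfResE _ sAT) ?group1 // (Clifford_Res_sum_cfclass nsAT Ts) De.
  rewrite cfclass_invariant ?subsetIr // big_seq1 !cfunE normrM.
  by rewrite normC_lin_char // lin_char1 // normr_nat mulr1.
have -> : 'chi_i 1%g = #|X : T|%:R * 'chi_s 1%g.
  by rewrite Di cfIirrE ?IndT // cfInd1.
rewrite nCdivE -(Lagrange_index sTX sAT) natrM dvdC_mul2l ?natr_indexg_neq0 //.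
apply: dvdC_trans (dvd_irr1_index_center s) _.
by rewrite dvdC_nat indexgS.
Qed.

Lemma char_prime_norm (gT : finGroupType) (W : {group gT}) (chi : 'CF(W)) :
    prime #|W| -> chi \is a character -> ~~ (#|W| %| chi 1%g)%C ->
  #|W|%:R - 1 <= \sum_(x in W^#) `|chi x| ^+ 2.
Proof.
move=> prW Nchi ndv; have cWW := cyclic_abelian (prime_cyclic prW).
pose a i := Num.truncn '[chi, 'chi_i].
have aE i : '[chi, 'chi_i] = (a i)%:R by rewrite truncnK ?Cnat_cfdot_char_irr.
have chi1 : chi 1%g = (\sum_i a i)%:R.
  rewrite {1}[chi]cfun_sum_cfdot sum_cfunE natr_sum; apply: eq_bigr => i _.
  by rewrite cfunE aE lin_char1 ?mulr1 //; apply: char_abelianP.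
(* Parseval: both sides are |W| times the norm '[chi]. *)
have normchi : \sum_(x in W) `|chi x| ^+ 2 = #|W|%:R * (\sum_i a i ^ 2)%:R.
  apply: (canRL (mulVKf (neq0CG W))); rewrite -(cfnormE (cfun_onG chi)).
  rewrite cfdot_sum_irr natr_sum; apply: eq_bigr => i _.
  by rewrite aE conjC_nat natrX expr2.
have := @sum_sqr_ndvd _ (fun i : Iirr W => (a i)%:Z).
rewrite card_Iirr_abelian // -(rmorph_sum Posz) -(ler_int algC) /=.
rewrite chi1 dvdC_nat in ndv => /(_ ndv).
have -> : \sum_i (a i)%:Z ^+ 2 = (\sum_i a i ^ 2)%N.
  by rewrite (rmorph_sum Posz); apply: eq_bigr => i _; rewrite -rmorphXn.
rewrite rmorphD rmorphB rmorphXn rmorphM /= -!pmulrn -normchi.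
by rewrite (big_setD1 1%g) //= chi1 normr_nat [leLHS]addrC lerD2l.
Qed.

Lemma nclasses_cent1_abelian (gT : finGroupType) (A X : {group gT}) (w : gT) :
    A <| X -> abelian A -> w \in X -> prime #[w] -> ~~ (#[w] %| #|X : A|)%N ->
    'C_X[w] = A ->
  (#|classes X| + #|X : A| <= #|A| + #|classes (X / A)|)%N.
Proof.
move=> nsAX cAA Xw prw ndv defA; have [sAX nAX] := andP nsAX.
set p := #[w] in prw ndv; pose W := <[w]>%G.
have Aw : w \in A by rewrite -defA inE Xw cent1id.
have sWA : W \subset A by rewrite cycle_subG.
have sWX := subset_trans sWA sAX.
have p1_gt0 : 0 < p%:R - 1 :> algC by rewrite subr_gt0 ltr1n prime_gt1.
pose S i := \sum_(x in W^#) `|'chi[X]_i x| ^+ 2.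
have cardW1 : #|W^#|%:R = p%:R - 1 :> algC.
  by rewrite -[p]/(#|W|) (cardsD1 1%g W) group1 natrD addrC addKr.
have sumS : \sum_i S i = (p%:R - 1) * #|A|%:R.
  rewrite exchange_big /= -cardW1 mulr_natl -sumr_const.
  apply: eq_bigr => x /setD1P[nt_x Wx].
  have Xx := subsetP sWX x Wx.
  rewrite (eq_bigr _ (fun _ _ => normCK _)) second_orthogonality_relation //.
  (* Each nontrivial x in W generates W, hence has the same centralizer A as w. *)
  rewrite class_refl -defA -!cent_cycle.
  suff -> : <[x]> = W by [].
  apply/eqP; rewrite eqEcard cycle_subG Wx /=.
  have -> : #|W| = #[x]; last by [].
  by apply/esym/prime_nt_dvdP; rewrite ?order_eq1 ?order_dvdG.
pose K := [pred i : Iirr X | A \subset cfker 'chi_i].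
have cardK : #|K| = #|classes (X / A)|.
  rewrite -NirrE -[RHS]card_ord -(on_card_preimset (mod_Iirr_bij nsAX)).
  by apply: eq_card => i; rewrite !inE mod_IirrE ?cfker_mod.
have sumK : \sum_(i in K) S i = (p%:R - 1) * #|X : A|%:R.
  rewrite exchange_big /= -cardW1 mulr_natl -sumr_const.
  apply: eq_bigr => x /setD1P[_ Wx].
  rewrite -sum_norm_irr_quo ?(subsetP sWX) // coset_id ?(subsetP sWA) //.
  rewrite -card_quotient // -irr_sum_square; apply: eq_bigr => i _.
  by rewrite irr1_degree normr_nat.
have ge1S i : p%:R - 1 <= S i.
  have -> : S i = \sum_(x in W^#) `|'Res[W] 'chi_i x| ^+ 2.
    by apply: eq_bigr => x /setD1P[_ Wx]; rewrite cfResE.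
  apply: char_prime_norm; rewrite ?cfRes_char ?irr_char // cfRes1.
  apply: contra ndv => /dvdC_trans/(_ (Ito_degree i nsAX cAA)).
  by rewrite dvdC_nat.
rewrite -(ler_nat algC) -(ler_pM2l p1_gt0) !natrD !mulrDr -sumS -sumK.
have -> : #|classes X| = (#|K| + #|[predC K]|)%N.
  by rewrite cardC card_ord NirrE.
(* The contributions of [K] cancel; what remains is [ge1S] summed over the characters outside
   [K]. *)
rewrite [X in _ <= X + _](bigID [in K]) /= natrD mulrDr -cardK.
rewrite [leRHS]addrAC [leLHS]addrAC [X in X + _ <= _]addrC lerD2l.
by rewrite mulr_natr -sumr_const; apply: ler_sum.
Qed.

Theorem theoremC (p : nat) (F : fieldType) (charF : p \in [pchar F]%R)
  (V : finLmodType F) (gT : finGroupType) (G : {group gT})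
  (to : groupAction G [set: V])
  (linV : linear_action to)
  (faithfulV : [faithful G, on [set: V] | to])
  (coGV : coprime #|G| #|V|)
  (regularV : exists v : V, 'C_G[v | to]%g = 1%g) :
  ((#|classes [set: sdprod_by to]|%:Z <=
    #|V|%:Z - #|G|%:Z + #|classes G|%:Z)%R).
Proof.
have [v regv] := regularV.
set X := [set: sdprod_by to]%G; set A := (sdpair1 to @* [set: V])%G.
have /sdprod_context[nsAX _ _ _ _] := sdprod_sdpair to.
have cardA : #|A| = #|V| by rewrite card_injm ?injm_sdpair1 ?subsetT // cardsT.
have isoG : G \isog X / A.
  apply: isog_trans (sdprod_isog (sdprod_sdpair to)).
  exact: sub_isog (injm_sdpair2 to).
have cardXA : #|X : A| = #|G|.
  by rewrite -card_quotient ?normal_norm // (card_isog isoG).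
suff : (#|classes X| + #|X : A| <= #|A| + #|classes (X / A)|)%N.
  rewrite cardXA cardA -(nclasses_isog isoG).
  by rewrite -lez_nat !PoszD -lerBrDr addrAC.
have cAA : abelian A.
  exact: morphim_abelian (FinRing.zmod_abelian _).
pose w := sdpair1 to v.
have Aw : w \in A by apply: mem_morphim; rewrite inE.
have Xw : w \in X by rewrite inE.
(* A regular vector may be 0, but then G fixes it and is trivial, so X = A is abelian and the bound
   is immediate. *)
have [v0 | nz_v] := eqVneq v 0.
  have G1 : G :=: 1%g.
    apply/trivgP; rewrite -regv v0; apply/subsetP=> g Gg.
    by rewrite !inE Gg sub1set inE; apply/eqP/gact1.
  have XA : X :=: A.
    apply/eqP; rewrite eq_sym eqEsubset normal_sub //=.
    by rewrite -indexg_eq1 cardXA G1 cards1.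
  have /eqP -> : #|classes X| == #|X| by rewrite -card_classes_abelian XA.
  by rewrite XA indexgg leq_add2l classes_gt0.
have prp := pcharf_prime charF.
have ov : #[v]%g = p.
  apply: nt_prime_order => //; rewrite FinRing.zmodXgE -scaler_nat.
  by rewrite (pcharf0 charF) scale0r.
have ow : #[w]%g = p by rewrite order_injm ?injm_sdpair1 ?inE.
apply: nclasses_cent1_abelian Xw _ _ _ => //.
- by rewrite ow.
(* The order p of v divides |V|, which is coprime to |G|. *)
- rewrite cardXA ow -prime_coprime //.
  by rewrite coprime_sym (coprime_dvdr _ coGV) // -cardsT -ov order_dvdG ?inE.
(* Dedekind's law: 'C_X[w] = A ><| ('C_X[w] :&: G). *)
- have sAC : A \subset 'C[w] by rewrite sub_cent1 (subsetP cAA).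
  rewrite -[RHS](sdprodg1 A) -(sdprod_modl (sdprod_sdpair to) sAC).
  congr (A ><| _).
  apply/trivgP/subsetP=> _ /setIP[/morphimP[g Gg _ ->] /cent1P cwg].
  (* Conjugation in X realizes the action, so an element of G commuting with w fixes v. *)
  suff : g \in 'C_G[v | to] by rewrite regv => /set1P->; rewrite morph1.
  rewrite inE Gg !inE Gg sub1set inE; apply/eqP.
  apply: (injmP (injm_sdpair1 to)); rewrite ?inE //= sdpair_act ?inE //.
  by rewrite -/w conjgE -cwg mulKg.
Qed.
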